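(* Let $n\ge2$ and let $H$ be a group with elements $h_1,\ldots,h_n$ constituting a basis for $H$. Then the ring $P(f_H)$ and its action on $H/Z(H)$ and $Z(H)$ are absolutely interpretable in $H$.
   Context: Commutators: $[x,y]=x^{-1}y^{-1}xy$; $[A,B]$ is the subgroup generated by all $[a,b]$, $a\in A,b\in B$ (and $[h,B]=[\{h\},B]$). Basis. Let $H$ be a group with distinct nontrivial elements $h_1,\ldots,h_n$. Then $\{h_1,\ldots,h_n\}$ is a basis for $H$ if there are subgroups $H_i$ ($1\le i\le n$), $H_{ij}$ ($1\le i<j\le n$) of $H$ with: (1) $H_i=C_H(h_i)$ and $H_{ij}=[h_i,H_j]=[H_i,h_j]=[H_i,H_j]$ for $i<j$; (2) $H_i\cap H_j=Z(H)$ for $i<j$; (3) $[H_i,H_i]=1$; (4) $[H,H]\subseteq Z(H)$; (5)(a) every element of $H$ can be written as $u_nu_{n-1}\cdots u_1v$ with $u_i\in H_i$, $v\in Z(H)$, and each $u_i$ is unique modulo $Z(H)$; (5)(b) each $v\in Z(H)$ can be uniquely written as $u_{12}\cdots u_{1n}u_{23}\cdots u_{n-1,n}$ with $u_{ij}\in H_{ij}$. (In this case $Z(H)=[H,H]$.) For such $H$, $f_H:H/Z(H)\times H/Z(H)\to Z(H)$ is the bilinear map $(xZ(H),yZ(H))\mapsto[x,y]$, and $P(f_H)$ is the commutative associative unital ring of all pairs $(\phi_1,\phi_0)\in \mathrm{End}(H/Z(H))\times\mathrm{End}(Z(H))$ satisfying $f_H(\phi_1(u),w)=f_H(u,\phi_1(w))=\phi_0(f_H(u,w))$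 for all $u,w\in H/Z(H)$, with coordinatewise addition and composition; it acts on $H/Z(H)$ via $\phi_1$ and on $Z(H)$ via $\phi_0$. A structure $\mathfrak{U}$ (possibly many-sorted; operations regarded as relations) is absolutely interpretable in $\mathfrak{B}$ if it is isomorphic to a structure each of whose sorts is a quotient of a nonempty parameter-free first-order definable subset of some power $|\mathfrak{B}|^m$ by a parameter-free definable equivalence relation, with all basic relations induced by parameter-free first-order formulas of the signature of $\mathfrak{B}$. The claim refers to the many-sorted structure $\langle P(f_H),H/Z(H),Z(H),s_{H/Z(H)},s_{Z(H)},\delta_{f_H}\rangle$, consisting of the ring $P(f_H)$, the groups $H/Z(H)$ and $Z(H)$, the predicates $s_{H/Z(H)},s_{Z(H)}$ describing the actions of $P(f_H)$, and the predicate $\delta_{f_H}$ describing $f_H$. $H$ is considered in the signature of groups. *)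

(* Defs.v *)
From HB Require Import structures.
From mathcomp Require Import all_boot all_order all_algebra.
From mathcomp Require Import boolp classical_sets.

Set Implicit Arguments.
Unset Strict Implicit.
Unset Printing Implicit Defensive.

Local Open Scope classical_set_scope.
Local Open Scope group_scope.

(* A [groupType] may be infinite; [~ x, y] unfolds to x^-1 * (y^-1 * (x * y)). *)

Definition is_subgroup (H : groupType) (A : set H) : Prop :=
  A 1 /\ forall x y, A x -> A y -> A (x / y).

Definition generated (H : groupType) (A : set H) : set H :=
  [set x | forall K : set H, is_subgroup K -> A `<=` K -> K x].

Definition commutator (H : groupType) (A B : set H) : set H :=
  generated [set [~ a, b] | a in A & b in B].

Definition centralizer (H : groupType) (h : H) : set H :=
  [set x | commute x h].

Definition center (H : groupType) : set H :=
  [set z | forall x, commute z x].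
Arguments center : clear implicits.

Definition class2 (H : groupType) : Prop :=
  commutator [set: H] [set: H] `<=` center H.

(* The indices 1, ..., n become 0, ..., n.-1. [Hs i] is H_i and [Hss i j] is   *)
(* H_ij, which is meaningful only for i < j.                                   *)
Record basis_with (H : groupType) (n : nat) (h : 'I_n -> H)
    (Hs : 'I_n -> set H) (Hss : 'I_n -> 'I_n -> set H) : Prop := BasisWith {
  basis_sub1 : forall i, is_subgroup (Hs i);
  basis_sub2 : forall i j : 'I_n, (i < j)%N -> is_subgroup (Hss i j);
  basis_cent : forall i, Hs i = centralizer (h i);
  basis_comm : forall i j : 'I_n, (i < j)%N ->
    [/\ Hss i j = commutator [set h i] (Hs j),
        Hss i j = commutator (Hs i) [set h j]
      & Hss i j = commutator (Hs i) (Hs j)];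
  basis_cap : forall i j : 'I_n, (i < j)%N -> Hs i `&` Hs j = center H;
  basis_abel : forall i, commutator (Hs i) (Hs i) = [set 1];
  basis_nil : commutator [set: H] [set: H] `<=` center H;
  (* the product below is u_n.-1 ... u_1 u_0 v *)
  basis_gen : forall x : H, exists (u : 'I_n -> H) (v : H),
    [/\ forall i, Hs i (u i), center H v
      & x = (\prod_(i < n) u (rev_ord i)) * v];
  basis_gen_uniq : forall (u u' : 'I_n -> H) (v v' : H),
    (forall i, Hs i (u i)) -> (forall i, Hs i (u' i)) ->
    center H v -> center H v' ->
    (\prod_(i < n) u (rev_ord i)) * v = (\prod_(i < n) u' (rev_ord i)) * v' ->
    forall i, center H ((u i)^-1 * u' i);
  basis_zgen : forall z, center H z -> exists u : 'I_n -> 'I_n -> H,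
    (forall i j : 'I_n, (i < j)%N -> Hss i j (u i j)) /\
    z = \prod_(i < n) \prod_(j < n | (i < j)%N) u i j;
  basis_zgen_uniq : forall u u' : 'I_n -> 'I_n -> H,
    (forall i j : 'I_n, (i < j)%N -> Hss i j (u i j)) ->
    (forall i j : 'I_n, (i < j)%N -> Hss i j (u' i j)) ->
    \prod_(i < n) \prod_(j < n | (i < j)%N) u i j =
      \prod_(i < n) \prod_(j < n | (i < j)%N) u' i j ->
    forall i j : 'I_n, (i < j)%N -> u i j = u' i j
}.

Definition is_basis (H : groupType) (n : nat) (h : 'I_n -> H) : Prop :=
  [/\ injective h, forall i, h i != 1
    & exists (Hs : 'I_n -> set H) (Hss : 'I_n -> 'I_n -> set H),
        basis_with h Hs Hss].

Lemma basis_class2 (H : groupType) (n : nat) (h : 'I_n -> H) :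
  is_basis h -> class2 H.
Proof. by case=> _ _ [Hs] [Hss] /basis_nil. Qed.

Definition ZGroup (H : groupType) : Type := set_type (center H).

Section ZGroupTheory.
Variable H : groupType.

Lemma centerP (z : H) : reflect (center H z) (z \in center H).
Proof. by apply: (iffP idP); rewrite in_setE. Qed.

Fact center_closed : group_closed (fun z => z \in center H).
Proof.
split; first by apply/centerP => x; rewrite /commute mulg1 mul1g.
move=> x y /centerP cx /centerP cy; apply/centerP => z.
by apply/commute_sym/commuteM; [|apply: commuteV]; apply/commute_sym.
Qed.

HB.instance Definition _ := [isSub for (@sval _ _ : ZGroup H -> H)].
HB.instance Definition _ := [Choice of ZGroup H by <:].
HB.instance Definition _ :=
  SubChoice_isSubGroup.Build H (fun z => z \in center H) (ZGroup H)
    center_closed.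

Lemma val_center (z : ZGroup H) : center H (val z).
Proof. exact/centerP/(valP z). Qed.

Lemma ZvalM (y z : ZGroup H) : val (y * z) = val y * val z.
Proof. by []. Qed.

Lemma ZGroup_mulC (y z : ZGroup H) : y * z = z * y.
Proof. by apply: val_inj; rewrite !ZvalM; apply: val_center. Qed.

Definition zcongr (x y : H) : bool := x^-1 * y \in center H.

Fact zcongr_equiv : equiv_class_of zcongr.
Proof.
have [c1 cD] := center_closed.
have cV := group_closedV center_closed.
have cM := group_closedM center_closed.
split=> [x|x y|y x z xy yz].
- by rewrite /zcongr mulVg.
- by apply/idP/idP => /cV; rewrite invgM invgK.
have -> : zcongr x z = (x^-1 * y * (y^-1 * z) \in center H).
  by rewrite /zcongr !mulgA mulgK.
exact: cM.
Qed.

Canonical zcongr_rel := EquivRelPack zcongr_equiv.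

Definition QGroup : Type := {eq_quot zcongr}%qT.
HB.instance Definition _ := Choice.on QGroup.
HB.instance Definition _ := EqQuotient.on QGroup.

Definition coset (x : H) : QGroup := (\pi_QGroup x)%qT.

Lemma cosetP (x y : H) : coset x = coset y <-> center H (x^-1 * y).
Proof.
rewrite /coset; split=> [/eqP|/centerP xy].
  by rewrite eqmodE => /centerP.
by apply/eqP; rewrite eqmodE.
Qed.

Lemma coset_repr (u : QGroup) : coset (repr u) = u.
Proof. exact: reprK. Qed.

Let Qmul (u w : QGroup) := coset (repr u * repr w).
Let Qinv (u : QGroup) := coset (repr u)^-1.
Let Qone := coset 1.

Lemma cosetMr (x z : H) : center H z -> coset (x * z) = coset x.
Proof.
move=> cz; apply/esym/cosetP; suff -> : x^-1 * (x * z) = z by [].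
by rewrite mulgA mulVg mul1g.
Qed.

Lemma repr_coset (x : H) : exists2 z, center H z & repr (coset x) = x * z.
Proof.
exists (x^-1 * repr (coset x)); last by rewrite mulgA mulgV mul1g.
exact/cosetP/esym/coset_repr.
Qed.

Fact coset_mul (x y : H) : Qmul (coset x) (coset y) = coset (x * y).
Proof.
rewrite /Qmul; have [z cz ->] := repr_coset x; have [t ct ->] := repr_coset y.
rewrite (_ : x * z * (y * t) = x * y * (z * t)); last first.
  by rewrite -mulgA (mulgA z) (cz y) !mulgA.
by rewrite mulgA (cosetMr _ ct) (cosetMr _ cz).
Qed.

Fact coset_inv (x : H) : Qinv (coset x) = coset x^-1.
Proof.
rewrite /Qinv; have [z cz ->] := repr_coset x.
have cV : center H z^-1.
  exact/centerP/(group_closedV center_closed)/centerP.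
by rewrite invgM cV cosetMr.
Qed.

Fact Qmul1 : left_id Qone Qmul.
Proof. by move=> u; rewrite -(coset_repr u) coset_mul mul1g. Qed.
Fact Qmulr1 : right_id Qone Qmul.
Proof. by move=> u; rewrite -(coset_repr u) coset_mul mulg1. Qed.
Fact QmulA : associative Qmul.
Proof.
move=> u v w; rewrite -(coset_repr u) -(coset_repr v) -(coset_repr w).
by rewrite !coset_mul mulgA.
Qed.
Fact QmulV : left_inverse Qone Qinv Qmul.
Proof. by move=> u; rewrite -(coset_repr u) coset_inv coset_mul mulVg. Qed.
Fact QmulrV : right_inverse Qone Qinv Qmul.
Proof. by move=> u; rewrite -(coset_repr u) coset_inv coset_mul mulgV. Qed.

HB.instance Definition _ := isGroup.Build QGroup QmulA Qmul1 Qmulr1 QmulV QmulrV.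

Lemma cosetM : {morph coset : x y / x * y}.
Proof. by move=> x y; rewrite -coset_mul. Qed.

End ZGroupTheory.
Arguments coset {H}.

Section PRing.
Variables (H : groupType) (c : class2 H).

Fact comm_center (x y : H) : [~ x, y] \in center H.
Proof. by apply/centerP/c => K _; apply; exists x => //; exists y. Qed.

(* f_H; the choice of representatives is immaterial by [formE].                *)
Definition form (u w : QGroup H) : ZGroup H :=
  exist _ [~ repr u, repr w] (comm_center (repr u) (repr w)).

Lemma comm_cent (x y z : H) : commute [~ x, y] z.
Proof. exact/centerP/comm_center. Qed.

Lemma commMl (x y z : H) : [~ x * y, z] = [~ x, z] * [~ y, z].
Proof.
apply: (mulgI (z * (x * y))); rewrite -commgC.
move: (commgC x z) (commgC y z) (comm_cent x z y).
move: [~ x, z] [~ y, z] => a b ex ey ca.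
by rewrite -mulgA ey !mulgA ex -(mulgA (z * x)) ca !mulgA.
Qed.

Lemma commMr (x y z : H) : [~ x, y * z] = [~ x, y] * [~ x, z].
Proof.
rewrite -(invgR (y * z) x) -(invgR y x) -(invgR z x) commMl invgM.
by rewrite !invgR comm_cent.
Qed.

Lemma formE (x y : H) : val (form (coset x) (coset y)) = [~ x, y].
Proof.
rewrite /=; have [z cz ->] := repr_coset x; have [t ct ->] := repr_coset y.
have czl a : [~ z, a] = 1 by apply/eqP/commgP/cz.
have ctr a : [~ a, t] = 1 by apply/eqP/commgP/commute_sym/ct.
by rewrite commMl !commMr czl czl ctr !mulg1.
Qed.

Lemma formMl (u v w : QGroup H) : form (u * v) w = form u w * form v w.
Proof.
apply: val_inj; rewrite ZvalM -(coset_repr u) -(coset_repr v) -(coset_repr w).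
by rewrite -cosetM !formE commMl.
Qed.

Lemma formMr (u v w : QGroup H) : form u (v * w) = form u v * form u w.
Proof.
apply: val_inj; rewrite ZvalM -(coset_repr u) -(coset_repr v) -(coset_repr w).
by rewrite -cosetM !formE commMr.
Qed.

Lemma QGroup_mulC (u w : QGroup H) : u * w = w * u.
Proof.
rewrite -(coset_repr u) -(coset_repr w) -!cosetM.
by rewrite commgC; apply/cosetMr/comm_cent.
Qed.

Lemma form1l (u : QGroup H) : form 1 u = 1.
Proof. by apply: (mulgI (form 1 u)); rewrite -formMl !mulg1. Qed.

Lemma form1r (u : QGroup H) : form u 1 = 1.
Proof. by apply: (mulgI (form u 1)); rewrite -formMr !mulg1. Qed.

Lemma formVl (u w : QGroup H) : form u^-1 w = (form u w)^-1.
Proof. by apply: (mulgI (form u w)); rewrite -formMl !mulgV form1l. Qed.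

Lemma formVr (u w : QGroup H) : form u w^-1 = (form u w)^-1.
Proof. by apply: (mulgI (form u w)); rewrite -formMr !mulgV form1r. Qed.

(* A pair (phi_1, phi_0) of endomorphisms is recorded as (act1, act0).         *)
Record PRing : Type := MkPRing {
  act1 : QGroup H -> QGroup H;
  act0 : ZGroup H -> ZGroup H;
  act1M : {morph act1 : u w / u * w};
  act0M : {morph act0 : y z / y * z};
  act_form : forall u w : QGroup H,
    form (act1 u) w = form u (act1 w) /\ form u (act1 w) = act0 (form u w)
}.

HB.instance Definition _ := gen_eqMixin PRing.
HB.instance Definition _ := gen_choiceMixin PRing.

Lemma PRing_eq (p q : PRing) : act1 p =1 act1 q -> act0 p =1 act0 q -> p = q.
Proof.
case: p q => [p1 p0 p1M p0M pf] [q1 q0 q1M q0M qf] /= /funext e1 /funext e0.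
case: q1 / e1 q1M qf => q1M qf; case: q0 / e0 q0M qf => q0M qf.
by congr MkPRing; apply: Prop_irrelevance.
Qed.

Lemma act_formr (p : PRing) u w : form u (act1 p w) = act0 p (form u w).
Proof. by case: (act_form p u w). Qed.

Lemma act_forml (p : PRing) u w : form (act1 p u) w = act0 p (form u w).
Proof. by rewrite -act_formr; case: (act_form p u w). Qed.

Fact add1M (p q : PRing) :
  {morph (fun u => act1 p u * act1 q u) : u w / u * w}.
Proof.
move=> u w; rewrite !act1M -!mulgA; congr (_ * _).
by rewrite !mulgA; congr (_ * _); apply: QGroup_mulC.
Qed.

Fact add0M (p q : PRing) :
  {morph (fun z => act0 p z * act0 q z) : y z / y * z}.
Proof.
move=> y z; rewrite !act0M -!mulgA; congr (_ * _).
by rewrite !mulgA; congr (_ * _); apply: ZGroup_mulC.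
Qed.

Fact add_form (p q : PRing) u w :
  form (act1 p u * act1 q u) w = form u (act1 p w * act1 q w) /\
  form u (act1 p w * act1 q w) = act0 p (form u w) * act0 q (form u w).
Proof. by rewrite formMl formMr !act_forml !act_formr. Qed.

Fact opp1M (p : PRing) : {morph (fun u => (act1 p u)^-1) : u w / u * w}.
Proof. by move=> u w; rewrite act1M invgM QGroup_mulC. Qed.

Fact opp0M (p : PRing) : {morph (fun z => (act0 p z)^-1) : y z / y * z}.
Proof. by move=> y z; rewrite act0M invgM ZGroup_mulC. Qed.

Fact opp_form (p : PRing) u w :
  form (act1 p u)^-1 w = form u (act1 p w)^-1 /\
  form u (act1 p w)^-1 = (act0 p (form u w))^-1.
Proof. by rewrite formVl formVr act_forml act_formr. Qed.

Fact zeroM (G : groupType) : {morph (fun _ : G => 1 : G) : x y / x * y}.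
Proof. by move=> x y; rewrite mulg1. Qed.

Fact zero_form (u w : QGroup H) : form 1 w = form u 1 /\ form u 1 = 1.
Proof. by rewrite form1l form1r. Qed.

Fact mul1M (p q : PRing) : {morph (act1 p \o act1 q) : u w / u * w}.
Proof. by move=> u w; rewrite /= !act1M. Qed.

Fact mul0M (p q : PRing) : {morph (act0 p \o act0 q) : y z / y * z}.
Proof. by move=> y z; rewrite /= !act0M. Qed.

Fact mul_form (p q : PRing) u w :
  form ((act1 p \o act1 q) u) w = form u ((act1 p \o act1 q) w) /\
  form u ((act1 p \o act1 q) w) = (act0 p \o act0 q) (form u w).
Proof. by rewrite /= !act_forml !act_formr. Qed.

Definition Padd p q := MkPRing (add1M p q) (add0M p q) (add_form p q).
Definition Popp p := MkPRing (opp1M p) (opp0M p) (opp_form p).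
Definition Pzero := MkPRing (@zeroM _) (@zeroM _) zero_form.
Definition Pmul p q := MkPRing (mul1M p q) (mul0M p q) (mul_form p q).
Definition Pone : PRing :=
  @MkPRing id id (fun _ _ => erefl) (fun _ _ => erefl)
    (fun _ _ => conj erefl erefl).

Fact PaddA : associative Padd.
Proof. by move=> p q r; apply: PRing_eq => x /=; rewrite mulgA. Qed.
Fact PaddC : commutative Padd.
Proof.
by move=> p q; apply: PRing_eq => x /=; [apply: QGroup_mulC|apply: ZGroup_mulC].
Qed.
Fact Padd0 : left_id Pzero Padd.
Proof. by move=> p; apply: PRing_eq => x /=; rewrite mul1g. Qed.
Fact PaddN : left_inverse Pzero Popp Padd.
Proof. by move=> p; apply: PRing_eq => x /=; rewrite mulVg. Qed.
Fact PmulA : associative Pmul.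
Proof. by move=> p q r; apply: PRing_eq. Qed.
Fact Pmul1 : left_id Pone Pmul.
Proof. by move=> p; apply: PRing_eq. Qed.
Fact Pmulr1 : right_id Pone Pmul.
Proof. by move=> p; apply: PRing_eq. Qed.
Fact PmulDl : left_distributive Pmul Padd.
Proof. by move=> p q r; apply: PRing_eq. Qed.
Fact PmulDr : right_distributive Pmul Padd.
Proof. by move=> p q r; apply: PRing_eq => x /=; rewrite (act1M, act0M). Qed.

HB.instance Definition _ := GRing.isPzRing.Build PRing
  PaddA PaddC Padd0 PaddN PmulA Pmul1 Pmulr1 PmulDl PmulDr.

End PRing.

Lemma PRing_mulC (H : groupType) (n : nat) (h : 'I_n -> H) (hb : is_basis h) :
  commutative (@GRing.mul (PRing (basis_class2 hb))).
Proof.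
set c := basis_class2 hb; move=> p q.
have sw u w : act0 p (act0 q (form c u w)) = act0 q (act0 p (form c u w)).
  by rewrite -act_forml -act_formr act_forml act_formr.
apply: PRing_eq => [u|z] /=.
  set a := act1 p _; set b := act1 q _.
  rewrite -(coset_repr a) -(coset_repr b); apply/cosetP => x.
  suff : form c (a^-1 * b) (coset x) = 1.
    rewrite -{1}(coset_repr a) -{1}(coset_repr b) => /(congr1 val).
    rewrite (_ : (coset (repr a))^-1 = coset (repr a)^-1); last first.
      by apply: (mulgI (coset (repr a))); rewrite mulgV -cosetM mulgV.
    by rewrite -cosetM formE => /eqP/commgP.
  by rewrite formMl formVl !act_forml sw mulVg.
pose K : set H := [set x | exists2 y : ZGroup H, val y = x &
  act0 p (act0 q y) = act0 q (act0 p y)].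
have act01 (r : PRing c) : act0 r 1 = 1 :> ZGroup H.
  by apply: (mulgI (act0 r 1)); rewrite -act0M !mulg1.
have act0V (r : PRing c) y : act0 r y^-1 = (act0 r y)^-1.
  by apply: (mulgI (act0 r y)); rewrite -act0M !mulgV act01.
have K1 : K 1 by exists 1; rewrite ?act01.
have KM x y : K x -> K y -> K (x * y).
  by move=> [a <- ea] [b <- eb]; exists (a * b); rewrite // !act0M ea eb.
have KV x : K x -> K x^-1.
  by move=> [a <- ea]; exists a^-1; rewrite // !act0V ea.
suff [y /val_inj <-] : K (val z) by [].
case: (hb) => _ _ [Hs [Hss B]].
have [u [uH ->]] := basis_zgen B (val_center z).
apply: (big_ind K) => // i _; apply: (big_ind K) => // j ij.
have := uH i j ij; have [_ _ ->] := basis_comm B ij; apply.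
  by split=> // x y Kx /KV; apply: KM.
by move=> _ [a _ [b _ <-]]; exists (form c (coset a) (coset b)); rewrite ?formE.
Qed.

(* Formulas have their free variables in V and no parameters; a quantifier     *)
(* binds the variable [None].                                                  *)
Inductive term (V : Type) : Type :=
| Var of V
| One
| Mul of term V & term V
| Inv of term V.

Inductive formula (V : Type) : Type :=
| Eq of term V & term V
| Not of formula V
| And of formula V & formula V
| Or of formula V & formula V
| Imp of formula V & formula V
| All of formula (option V)
| Ex of formula (option V).

Fixpoint eval (G : groupType) (V : Type) (e : V -> G) (t : term V) : G :=
  match t with
  | Var v => e v
  | One => 1
  | Mul t1 t2 => eval e t1 * eval e t2
  | Inv t1 => (eval e t1)^-1
  end.

Definition extend (T V : Type) (e : V -> T) (x : T) (v : option V) : T :=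
  if v is Some w then e w else x.

Fixpoint sat (G : groupType) (V : Type) (phi : formula V) :
    (V -> G) -> Prop :=
  match phi with
  | Eq t1 t2 => fun e => eval e t1 = eval e t2
  | Not p => fun e => ~ sat p e
  | And p q => fun e => sat p e /\ sat q e
  | Or p q => fun e => sat p e \/ sat q e
  | Imp p q => fun e => sat p e -> sat q e
  | All p => fun e => forall x : G, sat p (extend e x)
  | Ex p => fun e => exists x : G, sat p (extend e x)
  end.

Record signature : Type := Signature {
  sort : Type;
  rel_symbol : Type;
  arity : rel_symbol -> nat;
  arg_sort : forall r : rel_symbol, 'I_(arity r) -> sort
}.

Record structure (S : signature) : Type := Structure {
  carrier : sort S -> Type;
  holds : forall r : rel_symbol S,
    (forall k : 'I_(arity r), carrier (arg_sort k)) -> Prop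
}.

Definition isomorphic (S : signature) (A B : structure S) : Prop :=
  exists f : forall s : sort S, carrier A s -> carrier B s,
    (forall s, bijective (f s)) /\
    (forall (r : rel_symbol S)
            (a : forall k : 'I_(arity r), carrier A (arg_sort k)),
       holds a <-> holds (fun k => f (arg_sort k) (a k))).

Record interpretation (S : signature) : Type := Interpretation {
  dim : sort S -> nat;
  dom_formula : forall s, formula 'I_(dim s);
  eqv_formula : forall s, formula ('I_(dim s) + 'I_(dim s));
  (* the variable (k, i) is the i-th coordinate of the k-th argument           *)
  rel_formula : forall r : rel_symbol S,
    formula {k : 'I_(arity r) & 'I_(dim (arg_sort k))}
}.

Section Interpretation.
Variables (S : signature) (I : interpretation S) (G : groupType).

Definition idom (s : sort S) : set ('I_(dim I s) -> G) :=
  [set x | sat (dom_formula I s) x].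

Definition ieqv (s : sort S) (x y : 'I_(dim I s) -> G) : Prop :=
  sat (eqv_formula I s)
    (fun v => match v with inl i => x i | inr i => y i end).

Definition irel (r : rel_symbol S)
    (x : forall k : 'I_(arity r), 'I_(dim I (arg_sort k)) -> G) : Prop :=
  sat (rel_formula I r) (fun v => x (tag v) (tagged v)).

Record admissible : Prop := Admissible {
  idom_nonempty : forall s, exists x, idom (s := s) x;
  ieqv_refl : forall s (x : 'I_(dim I s) -> G), idom x -> ieqv x x;
  ieqv_sym : forall s (x y : 'I_(dim I s) -> G),
    idom x -> idom y -> ieqv x y -> ieqv y x;
  ieqv_trans : forall s (x y z : 'I_(dim I s) -> G),
    idom x -> idom y -> idom z -> ieqv x y -> ieqv y z -> ieqv x z;
  irel_congr : forall (r : rel_symbol S)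
      (x y : forall k : 'I_(arity r), 'I_(dim I (arg_sort k)) -> G),
    (forall k, idom (x k)) -> (forall k, idom (y k)) ->
    (forall k, ieqv (x k) (y k)) -> irel x -> irel y
}.

(* Elements of a sort are the equivalence classes of the definable equivalence *)
(* relation on the definable set.                                              *)
Definition iclass (s : sort S) (x : 'I_(dim I s) -> G) :
  set ('I_(dim I s) -> G) := [set y | idom y /\ ieqv x y].

Definition icarrier (s : sort S) : Type :=
  {C : set ('I_(dim I s) -> G) | exists2 x, idom x & C = iclass x}.

Definition interpreted : structure S := {|
  carrier := icarrier;
  holds := fun r (a : forall k : 'I_(arity r), icarrier (arg_sort k)) =>
    exists x : forall k : 'I_(arity r), 'I_(dim I (arg_sort k)) -> G,
      (forall k, sval (a k) (x k)) /\ irel x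
|}.

End Interpretation.

Definition absolutely_interpretable (S : signature) (A : structure S)
    (G : groupType) : Prop :=
  exists I : interpretation S,
    admissible I G /\ isomorphic A (interpreted I G).

(* The sorts are P(f_H), H / Z(H) and Z(H); operations are given by their      *)
(* graphs.                                                                     *)
Variant P_sort := SortP | SortQ | SortZ.

Variant P_rel :=
| P_add | P_opp | P_mul | P_zero | P_one
| Q_mul | Q_inv | Q_one
| Z_mul | Z_inv | Z_one
| act_Q | act_Z | delta.

Definition P_args (r : P_rel) : seq P_sort :=
  match r with
  | P_add | P_mul => [:: SortP; SortP; SortP]
  | P_opp => [:: SortP; SortP]
  | P_zero | P_one => [:: SortP]
  | Q_mul => [:: SortQ; SortQ; SortQ]
  | Q_inv => [:: SortQ; SortQ]
  | Q_one => [:: SortQ]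
  | Z_mul => [:: SortZ; SortZ; SortZ]
  | Z_inv => [:: SortZ; SortZ]
  | Z_one => [:: SortZ]
  | act_Q => [:: SortP; SortQ; SortQ]
  | act_Z => [:: SortP; SortZ; SortZ]
  | delta => [:: SortQ; SortQ; SortZ]
  end.

Definition P_signature : signature := {|
  sort := P_sort;
  rel_symbol := P_rel;
  arity := fun r => size (P_args r);
  arg_sort := fun r k => nth SortP (P_args r) k
|}.

Section PStructure.
Variables (H : groupType) (c : class2 H).

Definition P_carrier (s : P_sort) : Type :=
  match s with
  | SortP => PRing c
  | SortQ => QGroup H
  | SortZ => ZGroup H
  end.

Let i1 {n} : 'I_n.+1 := @Ordinal n.+1 0 isT.
Let i2 {n} : 'I_n.+2 := @Ordinal n.+2 1 isT.
Let i3 {n} : 'I_n.+3 := @Ordinal n.+3 2 isT.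

Definition P_holds (r : P_rel) :
    (forall k : 'I_(size (P_args r)), P_carrier (nth SortP (P_args r) k)) ->
    Prop :=
  match r return
    (forall k : 'I_(size (P_args r)), P_carrier (nth SortP (P_args r) k)) ->
    Prop
  with
  | P_add => fun a => (a i1 + a i2 = a i3 :> PRing c)%R
  | P_opp => fun a => (- a i1 = a i2 :> PRing c)%R
  | P_mul => fun a => (a i1 * a i2 = a i3 :> PRing c)%R
  | P_zero => fun a => (a i1 = 0 :> PRing c)%R
  | P_one => fun a => (a i1 = 1 :> PRing c)%R
  | Q_mul => fun a => a i1 * a i2 = a i3 :> QGroup H
  | Q_inv => fun a => (a i1)^-1 = a i2 :> QGroup H
  | Q_one => fun a => a i1 = 1 :> QGroup H
  | Z_mul => fun a => a i1 * a i2 = a i3 :> ZGroup H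
  | Z_inv => fun a => (a i1)^-1 = a i2 :> ZGroup H
  | Z_one => fun a => a i1 = 1 :> ZGroup H
  | act_Q => fun a => act1 (a i1 : PRing c) (a i2) = a i3
  | act_Z => fun a => act0 (a i1 : PRing c) (a i2) = a i3
  | delta => fun a => form c (a i1) (a i2) = a i3
  end.

Definition P_structure : structure P_signature :=
  {| carrier := P_carrier : sort P_signature -> Type; holds := P_holds |}.

End PStructure.

(* Main.v *)
From mathcomp Require Import all_boot ssralg.
From mathcomp Require Import boolp classical_sets.
Require Import Defs.

Set Implicit Arguments.
Unset Strict Implicit.
Unset Printing Implicit Defensive.

Local Open Scope classical_set_scope.
Local Open Scope group_scope.

(** A pair (phi_1, phi_0) in P(f_H) is determined by phi_0, because f_H is
nondegenerate, and phi_0 is determined by finitely many values of phi_1. Every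
element of Z(H) is a product [h_1, b_1] ... [h_n, b_n] for a basis h_1, ..., h_n
([basis_spanning]), and phi_0 maps it to [y_1, b_1] ... [y_n, b_n] when y_i
represents phi_1(h_i Z(H)). So the tuple (h, y) codes the pair. To avoid the
parameters h, a code is any tuple (g, y) in which g has the same spanning
property and phi_1 sends each g_i Z(H) to y_i Z(H).

Being a code is a first-order property. A tuple (g, y) with g spanning is a
code if and only if every u has a companion v such that, for all w and b, the
equation [u, w] = [g_1, b_1] ... [g_n, b_n] implies
[v, w] = [y_1, b_1] ... [y_n, b_n] ([transfers_PRing], [codes_dom]). Indeed v is
then unique modulo Z(H), so that phi_1 and phi_0 can be read off from these
equations, and additivity and the identities of P(f_H) follow from
bilinearity. The graph of phi_0 is first-order as well: z is sent to z' when
some b expresses z through g and z' through y ([act_graphP]). The ring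
operations and equality of P(f_H) are conditions on the graphs of the phi_0.

The cosets of Z(H) are coded by their elements, and the elements of Z(H) by
themselves. As only the existence of formulas matters, the proof works with
the class of predicates definable in H, which is closed under the connectives
and under quantification over elements and tuples, and whose atomic members are
equations between words and finite products; [coding_interpretable] turns a
coding with definable domain, equality and relations into an interpretation. *)

(** * Definable predicates *)

Fixpoint rename_term (V W : Type) (f : V -> W) (t : term V) : term W :=
  match t with
  | Var v => Var (f v)
  | One => One W
  | Mul t1 t2 => Mul (rename_term f t1) (rename_term f t2)
  | Inv t1 => Inv (rename_term f t1)
  end.

Fixpoint rename (V : Type) (phi : formula V) (W : Type) (f : V -> W) :
    formula W :=
  match phi with
  | Eq t1 t2 => Eq (rename_term f t1) (rename_term f t2)
  | Not p => Not (rename p f)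
  | And p q => And (rename p f) (rename q f)
  | Or p q => Or (rename p f) (rename q f)
  | Imp p q => Imp (rename p f) (rename q f)
  | All p => All (rename p (omap f))
  | Ex p => Ex (rename p (omap f))
  end.

Section Definability.
Variable G : groupType.

Lemma eval_rename (V W : Type) (f : V -> W) (e : W -> G) (t : term V) :
  eval e (rename_term f t) = eval (e \o f) t.
Proof. by elim: t => //= [t1 -> t2 ->|t ->]. Qed.

Lemma extend_omap (V W : Type) (f : V -> W) (e : W -> G) (x : G) :
  extend e x \o omap f = extend (e \o f) x.
Proof. by apply/funext => -[]. Qed.

Lemma sat_rename (V : Type) (phi : formula V) (W : Type) (f : V -> W)
    (e : W -> G) :
  sat (rename phi f) e <-> sat phi (e \o f).
Proof.
elim: phi W f e => {V} [V s t|V p IHp|V p IHp q IHq|V p IHp q IHq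
    |V p IHp q IHq|V p IHp|V p IHp] W f e /=.
- by rewrite !eval_rename.
- by split=> h /IHp.
- by split=> -[/IHp ? /IHq].
- by split=> -[/IHp|/IHq]; tauto.
- by split=> h /IHp/h/IHq.
- by split=> sat_p x; have := sat_p x; rewrite IHp extend_omap.
- by split=> -[x sat_p]; exists x; move: sat_p; rewrite IHp extend_omap.
Qed.

(** Definability is relative to the fixed group [G]; the same formula need not
define the same notion in other groups. *)
Definition definable (V : Type) (P : (V -> G) -> Prop) : Prop :=
  exists phi : formula V, forall e, sat phi e <-> P e.

Definition definable_fun (V : Type) (t : (V -> G) -> G) : Prop :=
  exists s : term V, forall e, eval e s = t e.

Section Closure.
Variable V : Type.
Implicit Types (s t : (V -> G) -> G) (P Q : (V -> G) -> Prop).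

Lemma definable_var (v : V) : definable_fun (fun e => e v).
Proof. by exists (Var v). Qed.

Lemma definable_1 : definable_fun (fun _ : V -> G => 1).
Proof. by exists (One V). Qed.

Lemma definable_mul s t : definable_fun s -> definable_fun t ->
  definable_fun (fun e => s e * t e).
Proof.
by move=> [s' hs] [t' ht]; exists (Mul s' t') => e /=; rewrite hs ht.
Qed.

Lemma definable_inv s : definable_fun s -> definable_fun (fun e => (s e)^-1).
Proof. by move=> [s' hs]; exists (Inv s') => e /=; rewrite hs. Qed.

Lemma definable_comm s t : definable_fun s -> definable_fun t ->
  definable_fun (fun e => [~ s e, t e]).
Proof.
move=> ds dt; apply: definable_mul; first exact: definable_inv.
apply: definable_mul; first exact: definable_inv.
exact: definable_mul.
Qed.

Lemma definable_prod (n : nat) (t : 'I_n -> (V -> G) -> G) :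
  (forall i, definable_fun (t i)) ->
  definable_fun (fun e => \prod_(i < n) t i e).
Proof.
move=> dt; have [s hs] := choice dt.
exists (\big[@Mul V/One V]_(i < n) s i) => e.
by elim/big_rec2: _ => //= i x y _ ->; rewrite hs.
Qed.

Lemma definable_eq s t : definable_fun s -> definable_fun t ->
  definable (fun e => s e = t e).
Proof. by move=> [s' hs] [t' ht]; exists (Eq s' t') => e /=; rewrite hs ht. Qed.

Lemma definable_and P Q : definable P -> definable Q ->
  definable (fun e => P e /\ Q e).
Proof.
by move=> [p hp] [q hq]; exists (And p q) => e /=; rewrite hp hq.
Qed.

Lemma definable_imp P Q : definable P -> definable Q ->
  definable (fun e => P e -> Q e).
Proof.
by move=> [p hp] [q hq]; exists (Imp p q) => e /=; rewrite hp hq.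
Qed.

Lemma definable_all (P : (V -> G) -> G -> Prop) :
  definable (fun e : option V -> G => P (fun v => e (Some v)) (e None)) ->
  definable (fun e => forall x, P e x).
Proof.
by move=> [p hp]; exists (All p) => e /=; split=> h x; have := h x; rewrite hp.
Qed.

Lemma definable_ex (P : (V -> G) -> G -> Prop) :
  definable (fun e : option V -> G => P (fun v => e (Some v)) (e None)) ->
  definable (fun e => exists x, P e x).
Proof.
by move=> [p hp]; exists (Ex p) => e /=; split=> -[x h]; exists x; move: h;
  rewrite hp.
Qed.

End Closure.

Lemma definable_ext (V : Type) (P Q : (V -> G) -> Prop) :
  (forall e, P e <-> Q e) -> definable P -> definable Q.
Proof. by move=> PQ [p hp]; exists p => e; rewrite hp. Qed.

Lemma definable_rename (V W : Type) (f : V -> W) (P : (V -> G) -> Prop) :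
  definable P -> definable (fun e => P (fun v => e (f v))).
Proof.
by move=> [p hp]; exists (rename p f) => e; rewrite sat_rename hp.
Qed.

(** The quantified tuple is peeled off one coordinate at a time; the renamings
identify the coordinate [ord0] with the variable [None] that a quantifier
binds. *)
Lemma definable_exs (V : Type) (n : nat) (P : (V -> G) -> ('I_n -> G) -> Prop) :
  definable (fun e : V + 'I_n -> G =>
    P (fun v => e (inl v)) (fun i => e (inr i))) ->
  definable (fun e => exists x, P e x).
Proof.
elim: n P => [|n IHn] P dP.
  pose f (v : V + 'I_0) : V :=
    match v with inl v => v | inr i => match notF (ltn_ord i) with end end.
  apply: definable_ext (definable_rename f dP) => e.
  split=> [Pe|[x Px]]; first by exists (fun i => e (f (inr i))).
  by rewrite (_ : (fun i => _) = x) //; apply/funext => -[].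
pose cons (x : 'I_n -> G) x0 i := if unlift ord0 i is Some j then x j else x0.
apply: (@definable_ext _ (fun e => exists x x0, P e (cons x x0))) => [e|].
  split=> [[x [x0 Px]]|[x Px]]; first by exists (cons x x0).
  exists (fun i => x (lift ord0 i)), (x ord0).
  rewrite (_ : cons _ _ = x) //; apply/funext => i.
  by rewrite /cons; case: unliftP => [j|] ->.
apply: IHn; apply: definable_ex.
pose f (v : V + 'I_n.+1) : option (V + 'I_n) :=
  match v with
  | inl v => Some (inl v)
  | inr i => if unlift ord0 i is Some j then Some (inr j) else None
  end.
apply: definable_ext (definable_rename f dP) => e.
rewrite (_ : (fun i => _) = cons (fun i => e (Some (inr i))) (e None)) //.
by apply/funext => i; rewrite /f /cons; case: unlift.
Qed.

Lemma definable_alls (V : Type) (n : nat)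
    (P : (V -> G) -> ('I_n -> G) -> Prop) :
  definable (fun e : V + 'I_n -> G =>
    P (fun v => e (inl v)) (fun i => e (inr i))) ->
  definable (fun e => forall x, P e x).
Proof.
move=> [p hp].
have [q hq] : definable (fun e : V -> G => exists x : 'I_n -> G, ~ P e x).
  by apply: definable_exs; exists (Not p) => e /=; rewrite hp.
exists (Not q) => e /=; rewrite hq; split=> [h x|h [x]]; last exact.
by apply: contrapT => nP; apply: h; exists x.
Qed.

End Definability.

(** * Interpretations from codings *)

Section Coding.
Variables (S : signature) (A : structure S) (G : groupType).
Variables (d : sort S -> nat).
(** An element may have many codes, and the formulas for equality and for the
relations only need to be right on codes. That a tuple codes at most one element
is a consequence of [eqv_def]. *)
Variable codes : forall s, ('I_(d s) -> G) -> carrier A s -> Prop.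

Hypothesis inh : forall s, inhabited (carrier A s).
Hypothesis codes_onto : forall s (a : carrier A s), exists x, codes x a.
Hypothesis dom_def : forall s, definable (fun x => exists a, @codes s x a).
Hypothesis eqv_def : forall s,
  exists2 E : ('I_(d s) + 'I_(d s) -> G) -> Prop, definable E &
    forall e a b, codes (e \o inl) a -> codes (e \o inr) b -> (E e <-> a = b).
Hypothesis rel_def : forall r : rel_symbol S,
  exists2 Q : ({k : 'I_(arity r) & 'I_(d (arg_sort k))} -> G) -> Prop,
    definable Q &
    forall e (a : forall k : 'I_(arity r), carrier A (arg_sort k)),
      (forall k, codes (fun i => e (existT _ k i)) (a k)) ->
      (Q e <-> holds a).

(** An element corresponds to the set of its codes, which is a class of the
definable equivalence relation. *)
Lemma coding_interpretable : absolutely_interpretable A G.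
Proof.
have eqv s : exists phi : formula ('I_(d s) + 'I_(d s)),
    forall x y a b, codes x a -> codes y b ->
    (sat phi (fun v => match v with inl i => x i | inr i => y i end : G)
       <-> a = b).
  have [E [p hp] hE] := eqv_def s; exists p => x y a b xa yb.
  by rewrite hp; apply: hE.
have rel (r : rel_symbol S) :
    exists phi : formula {k : 'I_(arity r) & 'I_(d (arg_sort k))},
    forall (x : forall k : 'I_(arity r), 'I_(d (arg_sort k)) -> G)
           (a : forall k : 'I_(arity r), carrier A (arg_sort k)),
      (forall k, codes (x k) (a k)) ->
      (sat phi (fun v => x (tag v) (tagged v)) <-> holds a).
  by have [Q [p hp] hQ] := rel_def r; exists p => x a xa; rewrite hp; apply: hQ.
pose I := @Interpretation S d (fun s => projT1 (cid (dom_def s)))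
  (fun s => projT1 (cid (eqv s))) (fun r => projT1 (cid (rel r))).
have domP s (x : 'I_(d s) -> G) : idom (I := I) x <-> exists a, codes x a.
  by rewrite /idom /=; case: cid => p hp; apply: hp.
have eqvP s (x y : 'I_(d s) -> G) a b : codes x a -> codes y b ->
    (ieqv (I := I) x y <-> a = b).
  by move=> xa yb; rewrite /ieqv /=; case: cid => p hp; apply: hp.
have relP (r : rel_symbol S)
    (x : forall k : 'I_(arity r), 'I_(d (arg_sort k)) -> G)
    (a : forall k : 'I_(arity r), carrier A (arg_sort k)) :
    (forall k, codes (x k) (a k)) -> (irel (I := I) x <-> holds a).
  by move=> xa; rewrite /irel /=; case: cid => p hp; apply: hp.
(* The formula for equality does not see which of a and b the code x stands
   for: it holds of (x, x) because a = a, and so a = b. *)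
have codes_fun s (x : 'I_(d s) -> G) a b : codes x a -> codes x b -> a = b.
  by move=> xa xb; apply/(eqvP _ _ _ _ _ xa xb)/(eqvP _ _ _ _ _ xa xa).
exists I; split.
  split.
  - move=> s; have [a] := inh s; have [x xa] := codes_onto a.
    by exists x; apply/domP; exists a.
  - by move=> s x /domP[a xa]; apply/(eqvP _ _ _ _ _ xa xa).
  - move=> s x y /domP[a xa] /domP[b yb] /(eqvP _ _ _ _ _ xa yb) ab.
    exact/(eqvP _ _ _ _ _ yb xa).
  - move=> s x y z /domP[a xa] /domP[b yb] /domP[e ze].
    move=> /(eqvP _ _ _ _ _ xa yb) ab /(eqvP _ _ _ _ _ yb ze) be.
    by apply/(eqvP _ _ _ _ _ xa ze); rewrite ab.
  - move=> r x y dx dy xy.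
    pose a k := projT1 (cid ((domP _ _).1 (dx k))).
    have xa k : codes (x k) (a k) by rewrite /a; case: cid.
    have ya k : codes (y k) (a k).
      have /domP[b yb] := dy k.
      by have /(eqvP _ _ _ _ _ (xa k) yb) -> := xy k.
    by move=> /(relP _ _ _ xa)/(relP _ _ _ ya).
have classE s (a : carrier A s) :
    exists2 x, idom (I := I) x & [set y | codes y a] = iclass (I := I) x.
  have [x xa] := codes_onto a; exists x; first by apply/domP; exists a.
  apply/seteqP; split=> y /= => [ya|[/domP[b yb]]].
    by split; [apply/domP; exists a|apply/(eqvP _ _ _ _ _ xa ya)].
  by move=> /(eqvP _ _ _ _ _ xa yb) ->.
pose f s (a : carrier A s) : icarrier I G s := exist _ _ (classE s a).
exists f; split=> [s|r a].
  have onto (C : icarrier I G s) : exists a, f s a = C.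
    case: C => C hC; have [x /domP[a xa] CE] := hC; exists a.
    apply: eq_exist => /=; rewrite CE.
    apply/seteqP; split=> y /= => [ya|[/domP[b yb]]].
      by split; [apply/domP; exists a|apply/(eqvP _ _ _ _ _ xa ya)].
    by move=> /(eqvP _ _ _ _ _ xa yb) ->.
  have inj : injective (f s).
    move=> a b /(congr1 sval) /= ab; have [x xa] := codes_onto a.
    apply: codes_fun (xa) _.
    by rewrite -[codes x b]/([set y | codes y b] x) -ab.
  have [g fg] := choice onto.
  by exists g => // a; apply: inj.
split=> [ha|[x [xa /(relP _ _ _ xa)]] //].
pose x k := projT1 (cid (codes_onto (a k))).
have xa k : codes (x k) (a k) by rewrite /x; case: cid.
by exists x; split=> //; apply/(relP _ _ _ xa).
Qed.

End Coding.

(** * Pairs of endomorphisms determined by finitely many values *)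

Section Pairing.
Variables (H : groupType) (c : class2 H) (n : nat).
Implicit Types (g y b : 'I_n -> QGroup H) (u v w : QGroup H) (z : ZGroup H).

Lemma cosetV (x : H) : coset x^-1 = (coset x)^-1.
Proof. by apply: (mulgI (coset x)); rewrite mulgV -cosetM mulgV. Qed.

Lemma coset_eq1 (x : H) : coset x = 1 <-> center H x.
Proof. by have := cosetP 1 x; rewrite invg1 mul1g => <-; split=> /esym. Qed.

(** Nondegeneracy of f_H: the radical of the commutator form is the image of the
centre, which is trivial in H / Z(H). *)
Lemma form_inj u v : (forall w, form c u w = form c v w) -> u = v.
Proof.
move=> uv; rewrite -(coset_repr u) -(coset_repr v); apply/cosetP => x.
apply/commgP/eqP; rewrite commMl //.
have /(congr1 val) := uv (coset x).
rewrite -{1}(coset_repr u) -{1}(coset_repr v) !formE => <-.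
by rewrite -commMl // mulVg; apply/eqP/commgP; rewrite /commute mulg1 mul1g.
Qed.

(** The identity f_H(phi_1(u), w) = phi_0(f_H(u, w)) and nondegeneracy recover
phi_1 from phi_0, so the ring can be described by its action on Z(H). *)
Lemma act0_inj (p q : PRing c) : act0 p =1 act0 q -> p = q.
Proof.
move=> pq; apply: PRing_eq => // u; apply: form_inj => w.
by rewrite !act_forml pq.
Qed.

Lemma act0_1 (p : PRing c) : act0 p 1 = 1.
Proof. by apply: (mulgI (act0 p 1)); rewrite -act0M !mulg1. Qed.

Definition pairing g b : ZGroup H := \prod_(i < n) form c (g i) (b i).

Lemma val_pairing (g b : 'I_n -> H) :
  val (pairing (coset \o g) (coset \o b)) = \prod_(i < n) [~ g i, b i].
Proof.
rewrite (big_morph _ (@ZvalM H) (erefl : val (1 : ZGroup H) = 1)).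
by apply: eq_bigr => i _; rewrite formE.
Qed.

Lemma pairingM g b b' :
  pairing g (fun i => b i * b' i) = pairing g b * pairing g b'.
Proof.
rewrite /pairing; elim/big_rec3: _ => [|i x y t _ ->]; first by rewrite mulg1.
rewrite formMr -!mulgA; congr (_ * _).
by rewrite !mulgA [in LHS](ZGroup_mulC _ y).
Qed.

Lemma pairing1r g : pairing g (fun _ => 1) = 1.
Proof. by apply: big1 => i _; rewrite form1r. Qed.

Lemma pairingV g b : pairing g (fun i => (b i)^-1) = (pairing g b)^-1.
Proof.
apply: (mulgI (pairing g b)); rewrite mulgV -pairingM -(pairing1r g).
by apply: eq_bigr => i _; rewrite mulgV.
Qed.

Lemma pairing_single g i w :
  pairing g (fun j => if j == i then w else 1) = form c (g i) w.
Proof.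
transitivity (\prod_(j < n | j == i) form c (g j) w); last exact: big_pred1_eq.
rewrite [RHS]big_mkcond.
by apply: eq_bigr => j _; case: eqP; rewrite ?form1r.
Qed.

Lemma act0_pairing (p : PRing c) g b :
  act0 p (pairing g b) = pairing (fun i => act1 p (g i)) b.
Proof.
rewrite (big_morph _ (act0M p) (act0_1 p)).
by apply: eq_bigr => i _; rewrite act_forml.
Qed.

Lemma formC u w : form c u w = (form c w u)^-1.
Proof.
apply: val_inj; rewrite -(coset_repr u) -(coset_repr w) formE -invgR.
by rewrite -(formE c).
Qed.

Definition spanning g : Prop := forall z, exists b, pairing g b = z.

(** The first-order trace of phi_1(u) = v, when phi_1 sends [g i] to [y i]: then
phi_0 sends [pairing g b] to [pairing y b], and f_H(v, w) = phi_0(f_H(u, w)). *)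
Definition transfers g y u v : Prop :=
  forall w b, form c u w = pairing g b -> form c v w = pairing y b.

Section Transfer.
Variables (g y : 'I_n -> QGroup H) (span_g : spanning g).

Lemma transfers_uniq u v v' :
  transfers g y u v -> transfers g y u v' -> v = v'.
Proof.
move=> uv uv'; apply: form_inj => w; have [b /esym hb] := span_g (form c u w).
by rewrite (uv _ _ hb) (uv' _ _ hb).
Qed.

Lemma transfersM u u' v v' : transfers g y u v -> transfers g y u' v' ->
  transfers g y (u * u') (v * v').
Proof.
move=> uv uv' w b; rewrite !formMl => e.
have [b1 e1] := span_g (form c u w); rewrite (uv w b1) //.
rewrite (uv' w (fun i => (b1 i)^-1 * b i)); last first.
  by rewrite pairingM pairingV -e -e1 mulgA mulVg mul1g.
by rewrite pairingM pairingV mulgA mulgV mul1g.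
Qed.

Hypothesis total : forall u, exists v, transfers g y u v.

(** This makes phi_0 well defined. By additivity it suffices to treat
[pairing g b = 1], which is f_H(1, 1); so [pairing y b] is f_H(v, 1) for a
companion v of 1. *)
Lemma pairing_transfer b b' :
  pairing g b = pairing g b' -> pairing y b = pairing y b'.
Proof.
move=> bb'; have [v hv] := total 1.
apply: (mulgI (pairing y b)^-1); rewrite mulVg -pairingV -pairingM.
by rewrite -(hv 1) form1r // pairingM pairingV bb' mulVg.
Qed.

(** phi_1 sends [u] to its unique companion, and phi_0 sends [pairing g b] to
[pairing y b]. *)
Lemma transfers_PRing : exists p : PRing c, forall i, act1 p (g i) = y i.
Proof.
have [V hV] := choice total; have [B hB] := choice span_g.
have formV0 u w : form c (V u) w = pairing y (B (form c u w)).
  by apply: hV; rewrite hB.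
have formV1 u w : form c u (V w) = pairing y (B (form c u w)).
  rewrite formC formV0 -pairingV; apply: pairing_transfer.
  by rewrite pairingV !hB -formC.
have V1M : {morph V : u w / u * w}.
  by move=> u w; apply: transfers_uniq (hV _) (transfersM (hV u) (hV w)).
have V0M : {morph (fun z => pairing y (B z)) : z t / z * t}.
  move=> z t; rewrite -pairingM; apply: pairing_transfer.
  by rewrite pairingM !hB.
have Vform u w : form c (V u) w = form c u (V w) /\
    form c u (V w) = pairing y (B (form c u w)).
  by rewrite formV0 formV1.
exists (MkPRing V1M V0M Vform) => i /=.
apply: form_inj => w; rewrite formV0 -(pairing_single y).
by apply: pairing_transfer; rewrite hB pairing_single.
Qed.

End Transfer.

Lemma act1_transfers (p : PRing c) g u :
  transfers g (fun i => act1 p (g i)) u (act1 p u).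
Proof. by move=> w b; rewrite act_forml -act0_pairing => ->. Qed.

Lemma coset_lift (b : 'I_n -> QGroup H) :
  exists b' : 'I_n -> H, b = coset \o b'.
Proof.
by exists (fun i => repr (b i)); apply/funext => i /=; rewrite coset_repr.
Qed.

Lemma spanningP (g : 'I_n -> H) : spanning (coset \o g) <->
  forall z : H, center H z ->
    exists b : 'I_n -> H, z = \prod_(i < n) [~ g i, b i].
Proof.
split=> span_g z.
  move=> /centerP cz; have [b] := span_g (exist _ z cz).
  have [b' ->] := coset_lift b.
  by move=> /(congr1 val); rewrite val_pairing => /= <-; exists b'.
have [b zb] := span_g _ (val_center z); exists (coset \o b).
by apply: val_inj; rewrite val_pairing.
Qed.

Lemma transfersP (g y : 'I_n -> H) (u v : H) :
  transfers (coset \o g) (coset \o y) (coset u) (coset v) <->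
  forall (w : H) (b : 'I_n -> H), [~ u, w] = \prod_(i < n) [~ g i, b i] ->
    [~ v, w] = \prod_(i < n) [~ y i, b i].
Proof.
split=> tr w b.
  rewrite -!val_pairing -!(formE c) => /val_inj e.
  by rewrite (tr _ _ e).
have [b' ->] := coset_lift b; rewrite -(coset_repr w) => /(congr1 val).
rewrite formE val_pairing => /tr e; apply: val_inj.
by rewrite formE val_pairing.
Qed.

End Pairing.

(** * Codes in the group *)

Section PCoding.
Variables (H : groupType) (c : class2 H) (n : nat).

Definition P_dim (s : P_sort) : nat := if s is SortP then n + n else 1.

(** The first half of a code in the sort P is a spanning tuple [g], the second
half lists representatives of the values of phi_1 on [g]. *)
Definition codes (s : P_sort) : ('I_(P_dim s) -> H) -> P_carrier c s -> Prop :=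
  match s with
  | SortP => fun x p => spanning c (fun i => coset (x (lshift n i))) /\
      forall i, act1 p (coset (x (lshift n i))) = coset (x (rshift n i))
  | SortQ => fun x u => coset (x ord0) = u
  | SortZ => fun x z => x ord0 = val z
  end.

(** The graph of phi_0 for the pair coded by [x]: a coordinate tuple [b] of [s]
with respect to the first half is one of phi_0([s]) with respect to the
second half. *)
Definition act_graph (x : 'I_(n + n) -> H) (s t : H) : Prop :=
  exists b : 'I_n -> H, s = \prod_(i < n) [~ x (lshift n i), b i] /\
    t = \prod_(i < n) [~ x (rshift n i), b i].

Lemma act_graphP (x : 'I_(n + n) -> H) (p : PRing c) (s t : H) :
  codes (s := SortP) x p ->
  act_graph x s t <-> exists2 z, s = val z & t = val (act0 p z).
Proof.
move=> [span_x px].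
have pE b : val (act0 p (pairing c (coset \o (x \o lshift n)) (coset \o b))) =
    \prod_(i < n) [~ x (rshift n i), b i].
  rewrite act0_pairing -(val_pairing c); congr (val (pairing c _ _)).
  exact/funext.
split=> [[b [-> ->]]|[z -> ->]].
  exists (pairing c (coset \o (x \o lshift n)) (coset \o b)) => //.
  by rewrite val_pairing.
have [b] := span_x z; have [b' ->] := coset_lift b => <-; exists b'.
by rewrite -pE -val_pairing.
Qed.

(** Both conditions on the right speak of elements of H only, so they turn the
domain of the sort P into a first-order condition. *)
Lemma codes_dom (x : 'I_(n + n) -> H) :
  (exists p, codes (s := SortP) x p) <->
  (forall z, (forall t, z * t = t * z) ->
     exists b : 'I_n -> H, z = \prod_(i < n) [~ x (lshift n i), b i]) /\
  (forall u, exists v, forall w (b : 'I_n -> H),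
     [~ u, w] = \prod_(i < n) [~ x (lshift n i), b i] ->
     [~ v, w] = \prod_(i < n) [~ x (rshift n i), b i]).
Proof.
split=> [[p [span_x px]]|[span_x tr]].
  split=> [|u]; first exact/spanningP.
  exists (repr (act1 p (coset u))); apply/(transfersP c); rewrite coset_repr.
  rewrite (_ : coset \o (fun i => x (rshift n i)) =
    fun i => act1 p (coset (x (lshift n i)))); last exact/esym/funext.
  exact: act1_transfers.
have span_x' := (spanningP c _).2 span_x.
suff [p px] : exists p : PRing c, forall i,
    act1 p (coset (x (lshift n i))) = coset (x (rshift n i)) by exists p.
apply: transfers_PRing => // u; rewrite -(coset_repr u).
by have [v /(transfersP c) hv] := tr (repr u); exists (coset v).
Qed.

(** By [act0_inj] an element of the ring is determined by its action on Z(H), so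
equality and the ring operations become conditions on the graphs of the
phi_0. *)
Section RingGraphs.
Variables (x1 x2 x3 : 'I_(n + n) -> H) (p1 p2 p3 : PRing c).
Hypotheses (xp1 : codes (s := SortP) x1 p1) (xp2 : codes (s := SortP) x2 p2).
Hypothesis (xp3 : codes (s := SortP) x3 p3).

Lemma act_graph_val x p (z : ZGroup H) : codes (s := SortP) x p ->
  act_graph x (val z) (val (act0 p z)).
Proof. by move=> xp; apply/(act_graphP _ _ xp); exists z. Qed.

Lemma codes_act_Z z t : act_graph x1 (val z) (val t) <-> act0 p1 z = t.
Proof.
split=> [/(act_graphP _ _ xp1)[y /val_inj <- /val_inj]|<-] //.
exact: act_graph_val.
Qed.

Lemma codes_eq :
  (forall z a b, act_graph x1 z a -> act_graph x2 z b -> a = b) <-> p1 = p2.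
Proof.
split=> [E|p12 _ a b /(act_graphP _ _ xp1)[z -> ->]].
  by apply: act0_inj => z; apply/val_inj/(E (val z)); apply: act_graph_val.
by move=> /(act_graphP _ _ xp2)[_ /val_inj <- ->]; rewrite p12.
Qed.

Lemma codes_add :
  (forall z a b d, act_graph x1 z a -> act_graph x2 z b -> act_graph x3 z d ->
     a * b = d) <-> (p1 + p2 = p3)%R.
Proof.
split=> [E|p12 _ a b d /(act_graphP _ _ xp1)[z -> ->]].
  by apply: act0_inj => z; apply/val_inj/(E (val z)); apply: act_graph_val.
move=> /(act_graphP _ _ xp2)[_ /val_inj <- ->].
by move=> /(act_graphP _ _ xp3)[_ /val_inj <- ->]; rewrite -p12.
Qed.

Lemma codes_opp :
  (forall z a b, act_graph x1 z a -> act_graph x2 z b -> a^-1 = b) <->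
  (- p1 = p2)%R.
Proof.
split=> [E|p12 _ a b /(act_graphP _ _ xp1)[z -> ->]].
  by apply: act0_inj => z; apply/val_inj/(E (val z)); apply: act_graph_val.
by move=> /(act_graphP _ _ xp2)[_ /val_inj <- ->]; rewrite -p12.
Qed.

Lemma codes_mul :
  (forall z a b d, act_graph x2 z a -> act_graph x1 a b -> act_graph x3 z d ->
     b = d) <-> (p1 * p2 = p3)%R.
Proof.
split=> [E|p12 _ a b d /(act_graphP _ _ xp2)[z -> ->]].
  apply: act0_inj => z; apply/val_inj.
  by apply/(E (val z) (val (act0 p2 z))); apply: act_graph_val.
move=> /(act_graphP _ _ xp1)[_ /val_inj <- ->].
by move=> /(act_graphP _ _ xp3)[_ /val_inj <- ->]; rewrite -p12.
Qed.

Lemma codes_zero : (forall z a, act_graph x1 z a -> a = 1) <-> p1 = 0%R.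
Proof.
split=> [E|p10 _ a /(act_graphP _ _ xp1)[z _ ->]]; last by rewrite p10.
by apply: act0_inj => z; apply/val_inj/(E (val z)); apply: act_graph_val.
Qed.

Lemma codes_one : (forall z a, act_graph x1 z a -> a = z) <-> p1 = 1%R.
Proof.
split=> [E|p11 _ a /(act_graphP _ _ xp1)[z -> ->]]; last by rewrite p11.
by apply: act0_inj => z; apply/val_inj/(E (val z)); apply: act_graph_val.
Qed.

(** Companions with respect to a spanning tuple are unique in H / Z(H), so being
one characterizes phi_1(u). *)
Lemma codes_act_Q (u v : H) :
  (forall w (b : 'I_n -> H),
     [~ u, w] = \prod_(i < n) [~ x1 (lshift n i), b i] ->
     [~ v, w] = \prod_(i < n) [~ x1 (rshift n i), b i]) <->
  act1 p1 (coset u) = coset v.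
Proof.
have [span_x px] := xp1; rewrite -(transfersP c).
have tr : transfers c (coset \o (fun i => x1 (lshift n i)))
    (coset \o (fun i => x1 (rshift n i))) (coset u) (act1 p1 (coset u)).
  rewrite (_ : coset \o (fun i => x1 (rshift n i)) =
    fun i => act1 p1 (coset (x1 (lshift n i)))); last exact/esym/funext.
  exact: act1_transfers.
by split=> [/(transfers_uniq span_x tr)|<-].
Qed.

End RingGraphs.

End PCoding.

(** * Bases span the centre *)

(** A central element is a product of elements u_ij of the H_ij with i < j. For
fixed i the commutators [h_i, b] form a subgroup, as commutation is bilinear,
and this subgroup contains every H_ij, which is generated by such commutators.
Hence the product of the u_ij over j is a single [h_i, b]. *)
Lemma basis_spanning (H : groupType) (n : nat) (h : 'I_n -> H)
    (hb : is_basis h) : spanning (basis_class2 hb) (coset \o h).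
Proof.
have c := basis_class2 hb; apply/spanningP => z cz.
case: (hb) => _ _ [Hs [Hss B]]; have [u [uH ->]] := basis_zgen B cz.
suff step (i : 'I_n) :
    exists b, \prod_(j < n | (i < j)%N) u i j = [~ h i, b].
  by have [b hb'] := choice step; exists b; apply: eq_bigr.
pose K : set H := [set x | exists b, x = [~ h i, b]].
have K1 : K 1 by exists 1; rewrite commg1.
have KM x y : K x -> K y -> K (x * y).
  by move=> [a ->] [b ->]; exists (a * b); rewrite commMr.
have KV x : K x -> K x^-1.
  move=> [a ->]; exists a^-1; apply: (mulgI [~ h i, a]).
  by rewrite mulgV -commMr // mulgV commg1.
suff : K (\prod_(j < n | (i < j)%N) u i j) by [].
apply: (big_ind K) => // j ij.
have := uH i j ij; have [-> _ _] := basis_comm B ij; apply.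
  by split=> // x y Kx /KV; apply: KM.
by move=> _ [_ -> [b _ <-]]; exists b.
Qed.

(** * Definability of the coding *)

Lemma definable_act_graph (H : groupType) (n : nat) (V : Type)
    (x : 'I_(n + n) -> V) (s t : V) :
  definable (fun e : V -> H => act_graph (fun i => e (x i)) (e s) (e t)).
Proof.
apply: definable_exs; apply: definable_and; apply: definable_eq;
  try exact: definable_var;
  by apply: definable_prod => i; apply: definable_comm; apply: definable_var.
Qed.

Ltac definability := repeat first
  [ exact: definable_act_graph | exact: definable_var | exact: definable_1
  | apply: definable_eq => /= | apply: definable_comm => /=
  | apply: definable_mul => /= | apply: definable_inv => /=
  | apply: definable_prod => /= ?
  | apply: definable_and => /=
  | apply: definable_all => /= | apply: definable_ex => /=
  | apply: definable_alls => /= | apply: definable_exs => /=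
  | apply: definable_imp => /= ].

Lemma definable_codes (H : groupType) (c : class2 H) (n : nat) (s : P_sort) :
  definable (fun x : 'I_(P_dim n s) -> H => exists a, @codes H c n s x a).
Proof.
case: s.
- by apply: definable_ext (fun e => iff_sym (codes_dom c e)) _; definability.
- apply: (@definable_ext _ _ (fun e => e ord0 = e ord0)); last by definability.
  by move=> e; split=> // _; exists (coset (e ord0)).
- apply: (@definable_ext _ _ (fun e => center H (e ord0)));
    last by definability.
  move=> e; split=> [/centerP ce|[z] /= ->]; last exact: val_center.
  by exists (exist (fun z => z \in center H) _ ce).
Qed.

Lemma definable_codes_eq (H : groupType) (c : class2 H) (n : nat) (s : P_sort) :
  exists2 E : ('I_(P_dim n s) + 'I_(P_dim n s) -> H) -> Prop, definable E &
    forall e a b, @codes H c n s (e \o inl) a -> @codes H c n s (e \o inr) b ->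
      (E e <-> a = b).
Proof.
case: s.
- exists (fun e => forall z a b, act_graph (fun i => e (inl i)) z a ->
    act_graph (fun i => e (inr i)) z b -> a = b); first by definability.
  by move=> e p q; apply: codes_eq.
- exists (fun e => center H ((e (inl ord0))^-1 * e (inr ord0))).
    by definability.
  by move=> e u v /= <- <-; rewrite cosetP.
- exists (fun e => e (inl ord0) = e (inr ord0)); first by definability.
  by move=> e y z /= -> ->; split=> [/val_inj|->].
Qed.

Definition arg1 {m} : 'I_m.+1 := @Ordinal m.+1 0 isT.
Definition arg2 {m} : 'I_m.+2 := @Ordinal m.+2 1 isT.
Definition arg3 {m} : 'I_m.+3 := @Ordinal m.+3 2 isT.

Lemma definable_relations (H : groupType) (c : class2 H) (n : nat) (r : P_rel) :
  exists2 Q : ({k : 'I_(size (P_args r)) &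
                'I_(P_dim n (nth SortP (P_args r) k))} -> H) -> Prop,
    definable Q &
    forall e (a : forall k : 'I_(size (P_args r)),
                    P_carrier c (nth SortP (P_args r) k)),
      (forall k, @codes H c n _ (fun i => e (existT _ k i)) (a k)) ->
      (Q e <-> P_holds a).
Proof.
pose X (r : P_rel) (k : 'I_(size (P_args r)))
    (i : 'I_(P_dim n (nth SortP (P_args r) k))) :
  {k : 'I_(size (P_args r)) & 'I_(P_dim n (nth SortP (P_args r) k))} :=
  existT _ k i.
case: r.
- exists (fun e => forall z a b d,
    act_graph (fun i => e (X P_add arg1 i)) z a ->
    act_graph (fun i => e (X P_add arg2 i)) z b ->
    act_graph (fun i => e (X P_add arg3 i)) z d -> a * b = d).
    by definability.
  by move=> e a ca; apply: codes_add (ca arg1) (ca arg2) (ca arg3).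
- exists (fun e => forall z a b, act_graph (fun i => e (X P_opp arg1 i)) z a ->
    act_graph (fun i => e (X P_opp arg2 i)) z b -> a^-1 = b).
    by definability.
  by move=> e a ca; apply: codes_opp (ca arg1) (ca arg2).
- exists (fun e => forall z a b d,
    act_graph (fun i => e (X P_mul arg2 i)) z a ->
    act_graph (fun i => e (X P_mul arg1 i)) a b ->
    act_graph (fun i => e (X P_mul arg3 i)) z d -> b = d).
    by definability.
  by move=> e a ca; apply: codes_mul (ca arg1) (ca arg2) (ca arg3).
- exists (fun e => forall z a, act_graph (fun i => e (X P_zero arg1 i)) z a ->
    a = 1); first by definability.
  by move=> e a ca; apply: codes_zero (ca arg1).
- exists (fun e => forall z a, act_graph (fun i => e (X P_one arg1 i)) z a ->
    a = z); first by definability.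
  by move=> e a ca; apply: codes_one (ca arg1).
- exists (fun e => center H (
    (e (X Q_mul arg1 ord0) * e (X Q_mul arg2 ord0))^-1 *
    e (X Q_mul arg3 ord0))); first by definability.
  move=> e a ca; rewrite /P_holds -(ca arg1 : coset _ = _).
  by rewrite -(ca arg2 : coset _ = _) -(ca arg3 : coset _ = _) -cosetM cosetP.
- exists (fun e => center H (e (X Q_inv arg1 ord0) * e (X Q_inv arg2 ord0))).
    by definability.
  move=> e a ca; rewrite /P_holds -(ca arg1 : coset _ = _).
  by rewrite -(ca arg2 : coset _ = _) -cosetV cosetP invgK.
- exists (fun e => center H (e (X Q_one arg1 ord0))); first by definability.
  move=> e a ca; rewrite /P_holds -(ca arg1 : coset _ = _).
  by rewrite coset_eq1.
- exists (fun e => e (X Z_mul arg1 ord0) * e (X Z_mul arg2 ord0) =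
    e (X Z_mul arg3 ord0)); first by definability.
  move=> e a ca; rewrite (ca arg1 : _ = val _) (ca arg2 : _ = val _).
  by rewrite (ca arg3 : _ = val _) -ZvalM; split=> [/val_inj|<-].
- exists (fun e => (e (X Z_inv arg1 ord0))^-1 = e (X Z_inv arg2 ord0)).
    by definability.
  move=> e a ca; rewrite (ca arg1 : _ = val _) (ca arg2 : _ = val _).
  by split=> [E|<-] //; apply: val_inj.
- exists (fun e => e (X Z_one arg1 ord0) = 1); first by definability.
  move=> e a ca; rewrite (ca arg1 : _ = val _).
  by split=> [E|->] //; apply: val_inj.
- exists (fun e => forall w (b : 'I_n -> H), [~ e (X act_Q arg2 ord0), w] =
      \prod_(i < n) [~ e (X act_Q arg1 (lshift n i)), b i] ->
    [~ e (X act_Q arg3 ord0), w] =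
      \prod_(i < n) [~ e (X act_Q arg1 (rshift n i)), b i]).
    by definability.
  move=> e a ca; rewrite /P_holds -(ca arg2 : coset _ = _).
  rewrite -(ca arg3 : coset _ = _).
  exact: (codes_act_Q (ca arg1)).
- exists (fun e => act_graph (fun i => e (X act_Z arg1 i))
    (e (X act_Z arg2 ord0)) (e (X act_Z arg3 ord0))); first by definability.
  move=> e a ca; rewrite (ca arg2 : _ = val _) (ca arg3 : _ = val _).
  exact: (codes_act_Z (ca arg1)).
- exists (fun e => [~ e (X delta arg1 ord0), e (X delta arg2 ord0)] =
    e (X delta arg3 ord0)); first by definability.
  move=> e a ca; rewrite /P_holds -(ca arg1 : coset _ = _).
  rewrite -(ca arg2 : coset _ = _) (ca arg3 : _ = val _) -(formE c).
  by split=> [/val_inj|<-].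
Qed.

Theorem lemma6p4 (H : groupType) (n : nat) (hn : (2 <= n)%N) (h : 'I_n -> H)
  (hb : is_basis h) :
  absolutely_interpretable (P_structure (basis_class2 hb)) H.
Proof.
set c := basis_class2 hb.
apply: (@coding_interpretable P_signature (P_structure c) H (P_dim n)
  (@codes H c n)).
- by case; constructor; [exact: (Pzero c)|exact: 1|exact: 1].
- case=> [p|u|z].
  + exists (fun k => match split k with
      inl i => h i | inr i => repr (act1 p (coset (h i))) end); split.
      rewrite (_ : (fun i => _) = coset \o h); first exact: basis_spanning.
      by apply/funext => i /=; rewrite (unsplitK (inl i)).
    by move=> i; rewrite (unsplitK (inl i)) (unsplitK (inr i)) coset_repr.
  + by exists (fun _ => repr u); apply: coset_repr.
  + by exists (fun _ => val z).
- exact: definable_codes.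
- exact: definable_codes_eq.
- exact: definable_relations.
Qed.
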